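(* Let $(M,g)$ be a connected real analytic Riemannian manifold with Levi-Civita connection $\nabla$, let $J\subset\mathbb{R}$ be an open interval with $0\in J$, let $\gamma:J\to M$ be a geodesic with unit initial vector $\gamma'(0)$, and let $X$ be a differentiable vector field along $\gamma$. Then for every integer $n\ge 1$ and every $t\in J$, $$R^{n)}_t(X(t))=\nabla_{\gamma'}^{\,n}\bigl(R(X,\gamma')\gamma'\bigr)(t)-\sum_{i=1}^{n}\binom{n}{i}\,R^{n-i)}_t\bigl((\nabla_{\gamma'}^{\,i}X)(t)\bigr).$$
   Context: $R$ is the curvature tensor of $\nabla$, with the Kobayashi-Nomizu convention $R(X,Y)Z=\nabla_X\nabla_YZ-\nabla_Y\nabla_XZ-\nabla_{[X,Y]}Z$. The Jacobi operator along $\gamma$ is the self-adjoint tensor field $R_t=R(\cdot,\gamma')\gamma'(t)$. Its $i$-th covariant derivative along $\gamma$ is $R^{i)}_t=(\nabla_{\gamma'}\cdots\nabla_{\gamma'}R)(\cdot,\gamma')\gamma'(t)$, with $i$ covariant derivatives of the tensor $R$, and $R^{0)}_t=R_t$. $\nabla_{\gamma'}^{\,i}$ denotes $i$-fold covariant differentiation along $\gamma$. ''Differentiable'' means $C^\infty$. *)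

(* Defs.v *)
From HB Require Import structures.
From mathcomp Require Import all_boot all_order all_algebra.
From mathcomp Require Import all_classical all_reals all_analysis.

Set Implicit Arguments.
Unset Strict Implicit.
Unset Printing Implicit Defensive.

Import Order.TTheory GRing.Theory Num.Theory.
Import numFieldNormedType.Exports.

Local Open Scope classical_set_scope.
Local Open Scope ring_scope.

Fixpoint Ck {R : realType} {V W : normedModType R} (k : nat) (U : set V)
    (f : V -> W) : Prop :=
  if k is k'.+1 then
    (forall x, U x -> differentiable f x) /\ (forall v, Ck k' U ('D_v f))
  else forall x, U x -> {for x, continuous f}.

Definition smooth_on {R : realType} {V W : normedModType R} (U : set V)
  (f : V -> W) : Prop := forall k, Ck k U f.

(* Sum over the multi-indices alpha with |alpha| = k; the entries of such an
   alpha are at most k, so alpha ranges over a finite type. *)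
Definition homogeneous_part {R : realType} {d : nat} {W : lmodType R}
    (a : {ffun 'I_d -> nat} -> W) (k : nat) (y : 'rV[R]_d) : W :=
  \sum_(alpha : {ffun 'I_d -> 'I_k.+1} | (\sum_i alpha i)%N == k)
    (\prod_i y 0 i ^+ alpha i) *: a [ffun i => alpha i : nat].

(* f is near every point of U the sum of an absolutely convergent multivariate
   power series.  Such an f is automatically smooth; smoothness is listed for
   convenience. *)
Definition analytic_on {R : realType} {d : nat} {W : normedModType R}
    (U : set 'rV[R]_d) (f : 'rV[R]_d -> W) : Prop :=
  smooth_on U f /\
  forall x0, U x0 -> exists a : {ffun 'I_d -> nat} -> W,
    \forall x \near x0,
      cvgn (series (fun k => homogeneous_part (W := R^o)
                      (fun alpha => `|a alpha|) k (\row_i `|(x - x0) 0 i|)))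
      /\ series (fun k => homogeneous_part a k (x - x0)) @ \oo --> f x.

(* A real analytic manifold of dimension d, given by an atlas indexed by
   [cidx].  Each [cmap c] is a homeomorphism from the open set [cdom c] onto an
   open subset of R^d with inverse [cinv c]; the values of [cmap c] and [cinv c]
   outside these sets are irrelevant. *)
Record manifold (R : realType) (d : nat) := Manifold {
  mpoint :> topologicalType;
  cidx : Type;
  cdom : cidx -> set mpoint;
  cmap : cidx -> mpoint -> 'rV[R]_d;
  cinv : cidx -> 'rV[R]_d -> mpoint;
  mhausdorff : hausdorff_space mpoint;
  msecond_countable : @second_countable mpoint;
  ccover : forall p, exists c, cdom c p;
  cdom_open : forall c, open (cdom c);
  cimg_open : forall c, open (cmap c @` cdom c);
  cmapK : forall c p, cdom c p -> cinv c (cmap c p) = p;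
  cmap_continuous : forall c p, cdom c p -> {for p, continuous (cmap c)};
  cinv_continuous : forall c x, (cmap c @` cdom c) x ->
    {for x, continuous (cinv c)};
  ctransition : forall c c',
    analytic_on (cmap c @` (cdom c `&` cdom c')) (cmap c' \o cinv c)
}.

Arguments cidx {R d} M : rename.
Arguments cdom {R d M} c _ : rename.
Arguments cmap {R d M} c _ : rename.
Arguments cinv {R d M} c _ : rename.

Section Tangent.
Context {R : realType} {d : nat} (M : manifold R d) (p : M).

(* A tangent vector at p is the family of its coordinate vectors in the charts
   at p, subject to the usual transformation law; the entries at charts that do
   not contain p are set to 0 so that equality is Leibniz equality. *)
Definition is_tangent (v : cidx M -> 'rV[R]_d) : Prop :=
  (forall c, ~ cdom c p -> v c = 0) /\
  (forall c c', cdom c p -> cdom c' p ->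
     v c' = 'd (cmap c' \o cinv c) (cmap c p) (v c)).

Definition tangent_pred : pred (cidx M -> 'rV[R]_d) :=
  fun v => `[< is_tangent v >].

Fact tangent_submod_closed : submod_closed tangent_pred.
Proof.
split; first by apply/asboolP; split=> // c c' _ _; rewrite [RHS]linear0.
move=> a u v /asboolP[u0 uE] /asboolP[v0 vE]; apply/asboolP; split=> [c cp|].
  by rewrite !fctE u0// v0// scaler0 addr0.
by move=> c c' cp c'p; rewrite !fctE (uE c c')// (vE c c')// linearP.
Qed.

HB.instance Definition _ :=
  GRing.isSubmodClosed.Build R _ tangent_pred tangent_submod_closed.

Record tangent : Type :=
  Tangent { tcoord :> cidx M -> 'rV[R]_d; _ : tcoord \in tangent_pred }.

HB.instance Definition _ := [isSub for tcoord].
HB.instance Definition _ := [Choice of tangent by <:].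
HB.instance Definition _ := [SubChoice_isSubLmodule of tangent by <:].

End Tangent.

Section Manifold.
Context {R : realType} {d : nat} (M : manifold R d).

Definition smooth_fun (U : set M) (f : M -> R) : Prop :=
  forall c, smooth_on (cmap c @` (U `&` cdom c)) (f \o cinv c).

Definition analytic_fun (U : set M) (f : M -> R) : Prop :=
  forall c, analytic_on (cmap c @` (U `&` cdom c)) (f \o cinv c).

Definition vector_field : Type := forall p : M, tangent p.

Definition smooth_field (U : set M) (X : vector_field) : Prop :=
  forall c, smooth_on (cmap c @` (U `&` cdom c)) (fun x => X (cinv c x) c).

Definition analytic_field (U : set M) (X : vector_field) : Prop :=
  forall c, analytic_on (cmap c @` (U `&` cdom c)) (fun x => X (cinv c x) c).

Definition chart_at (p : M) : cidx M := projT1 (cid (ccover p)).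

(* The derivative v f of f in the direction v, computed in some chart at p; by
   the chain rule the choice does not matter when f is differentiable at p. *)
Definition dderiv (p : M) (v : tangent p) (f : M -> R) : R :=
  'D_(v (chart_at p)) (f \o cinv (chart_at p)) (cmap (chart_at p) p).

Definition is_lie_bracket (X Y B : vector_field) : Prop :=
  smooth_field setT B /\
  forall f, smooth_fun setT f -> forall p,
    dderiv (B p) f = dderiv (X p) (fun q => dderiv (Y q) f)
                   - dderiv (Y p) (fun q => dderiv (X q) f).

Definition lie_bracket (X Y : vector_field) : vector_field :=
  xget (fun=> 0) [set B | is_lie_bracket X Y B].

Record metric := Metric {
  metric_fun :> forall p : M, tangent p -> tangent p -> R;
  metricC : forall p (u v : tangent p), metric_fun u v = metric_fun v u;
  metricP : forall p (a : R) (u v w : tangent p),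
    metric_fun (a *: u + v) w = a * metric_fun u w + metric_fun v w;
  metric_gt0 : forall p (v : tangent p), v != 0 -> 0 < metric_fun v v;
  metric_analytic : forall (U : set M) X Y, open U ->
    analytic_field U X -> analytic_field U Y ->
    analytic_fun U (fun p => metric_fun (X p) (Y p))
}.

(* The Levi-Civita connection of g.  As everywhere below, the operators are
   total, and only their values on smooth arguments matter. *)
Record levi_civita (g : metric)
    (nabla : vector_field -> vector_field -> vector_field) : Prop := {
  nabla_smooth : forall X Y, smooth_field setT X -> smooth_field setT Y ->
    smooth_field setT (nabla X Y);
  nablaDl : forall X X' Y, smooth_field setT X -> smooth_field setT X' ->
    smooth_field setT Y ->
    forall p, nabla (fun q => X q + X' q) Y p = nabla X Y p + nabla X' Y p;
  nablaZl : forall f X Y, smooth_fun setT f -> smooth_field setT X ->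
    smooth_field setT Y ->
    forall p, nabla (fun q => f q *: X q) Y p = f p *: nabla X Y p;
  nablaDr : forall X Y Y', smooth_field setT X -> smooth_field setT Y ->
    smooth_field setT Y' ->
    forall p, nabla X (fun q => Y q + Y' q) p = nabla X Y p + nabla X Y' p;
  nablaZr : forall f X Y, smooth_fun setT f -> smooth_field setT X ->
    smooth_field setT Y ->
    forall p, nabla X (fun q => f q *: Y q) p =
              dderiv (X p) f *: Y p + f p *: nabla X Y p;
  nabla_torsion_free : forall X Y, smooth_field setT X -> smooth_field setT Y ->
    forall p, nabla X Y p - nabla Y X p = lie_bracket X Y p;
  nabla_metric : forall X Y Z, smooth_field setT X -> smooth_field setT Y ->
    smooth_field setT Z ->
    forall p, dderiv (X p) (fun q => g q (Y q) (Z q)) =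
              g p (nabla X Y p) (Z p) + g p (Y p) (nabla X Z p)
}.

(* Smooth tensor fields T of type (1,3), regarded as trilinear maps
   (x, y, z) |-> T(x, y)z on each tangent space. *)
Record tensor13 := Tensor13 {
  tensor_fun :> forall p : M,
    tangent p -> tangent p -> tangent p -> tangent p;
  tensorP1 : forall p (a : R) (x x' y z : tangent p),
    tensor_fun (a *: x + x') y z = a *: tensor_fun x y z + tensor_fun x' y z;
  tensorP2 : forall p (a : R) (x y y' z : tangent p),
    tensor_fun x (a *: y + y') z = a *: tensor_fun x y z + tensor_fun x y' z;
  tensorP3 : forall p (a : R) (x y z z' : tangent p),
    tensor_fun x y (a *: z + z') = a *: tensor_fun x y z + tensor_fun x y z';
  tensor_smooth : forall (U : set M) X Y Z, open U ->
    smooth_field U X -> smooth_field U Y -> smooth_field U Z ->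
    smooth_field U (fun p => tensor_fun (X p) (Y p) (Z p))
}.

(* This determines Rm, since every tangent vector is the value of a globally
   defined smooth vector field. *)
Definition is_curvature
    (nabla : vector_field -> vector_field -> vector_field)
    (Rm : tensor13) : Prop :=
  forall X Y Z, smooth_field setT X -> smooth_field setT Y ->
    smooth_field setT Z ->
    forall p, Rm p (X p) (Y p) (Z p) =
      nabla X (nabla Y Z) p - nabla Y (nabla X Z) p
      - nabla (lie_bracket X Y) Z p.

(* Curves and fields along them are total functions on R; only their
   restriction to the open interval J matters. *)
Section Along.
Variables (J : set R) (gamma : R -> M).

Definition smooth_curve : Prop :=
  (forall t, J t -> {for t, continuous gamma}) /\
  forall c, smooth_on (J `&` gamma @^-1` cdom c) (cmap c \o gamma).

Definition along : Type := forall t : R, tangent (gamma t).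

Definition smooth_along (X : along) : Prop :=
  forall c, smooth_on (J `&` gamma @^-1` cdom c) (fun t => X t c).

(* gamma'(t): the tangent vector whose coordinates in each chart c are the
   derivative of the curve read in c. *)
Definition velocity : along := fun t =>
  xget 0 [set v : tangent (gamma t) |
    forall c, cdom c (gamma t) -> v c = ((cmap c \o gamma)^`())%classic t].

(* D is the covariant derivative along gamma induced by nabla.  In the last
   clause, nabla X Y at gamma(t) is the derivative of Y in the direction
   X(gamma(t)) = gamma'(t). *)
Record covariant_derivative
    (nabla : vector_field -> vector_field -> vector_field)
    (D : along -> along) : Prop := {
  cov_smooth : forall X, smooth_along X -> smooth_along (D X);
  covD : forall X Y, smooth_along X -> smooth_along Y ->
    forall t, J t -> D (fun s => X s + Y s) t = D X t + D Y t;
  covZ : forall (f : R -> R) X, smooth_on J f -> smooth_along X ->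
    forall t, J t -> D (fun s => f s *: X s) t = (f^`())%classic t *: X t + f t *: D X t;
  cov_induced : forall X Y, smooth_field setT X -> smooth_field setT Y ->
    forall t, J t -> X (gamma t) = velocity t ->
    D (fun s => Y (gamma s)) t = nabla X Y (gamma t)
}.

Definition geodesic (D : along -> along) : Prop :=
  forall t, J t -> D velocity t = 0.

(* Tensor fields of type (1,3) along gamma, as operators on fields along gamma,
   and their covariant derivative along gamma. *)
Definition tensor_along : Type := along -> along -> along -> along.

Definition restrict_tensor (T : tensor13) : tensor_along :=
  fun X Y Z t => T (gamma t) (X t) (Y t) (Z t).

Definition cov_tensor (D : along -> along) (T : tensor_along) : tensor_along :=
  fun X Y Z t =>
    D (T X Y Z) t - T (D X) Y Z t - T X (D Y) Z t - T X Y (D Z) t.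

(* The value at t of a tensorial operator A on fields along gamma, as a map on
   the tangent space at gamma(t): A(v) is A(V)(t) for any smooth field V along
   gamma with V(t) = v, and does not depend on V. *)
Definition value_at (A : along -> along) (t : R) (v : tangent (gamma t)) :
    tangent (gamma t) :=
  A (xget (fun=> 0) [set V : along | smooth_along V /\ V t = v]) t.

(* R^{n)}_t = (nabla_{gamma'} ... nabla_{gamma'} R)(., gamma')gamma'(t), with D
   the covariant derivative along gamma and Rm the curvature tensor. *)
Definition jacobi_operator (Rm : tensor13) (D : along -> along) (n : nat)
    (t : R) : tangent (gamma t) -> tangent (gamma t) :=
  value_at (fun X =>
    iter n (cov_tensor D) (restrict_tensor Rm) X velocity velocity) (t := t).

End Along.
End Manifold.

Arguments tensor_fun {R d M} _ p _ _ _.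
Arguments metric_fun {R d M} _ p _ _.

(* Main.v *)
From HB Require Import structures.
Require Import Defs.
From mathcomp Require Import all_boot all_order all_algebra.
From mathcomp Require Import all_classical all_reals all_analysis.
From mathcomp Require Import ring lra.

Set Implicit Arguments.
Unset Strict Implicit.
Unset Printing Implicit Defensive.

Import Order.TTheory GRing.Theory Num.Theory.
Import numFieldNormedType.Exports.

Local Open Scope classical_set_scope.
Local Open Scope ring_scope.

(** Write A_n for the operator X |-> (nabla^n R)(X, gamma')gamma' on fields along
    gamma, where nabla^n R is the n-fold covariant derivative of the curvature
    restricted to gamma.  The Leibniz rule that defines the covariant derivative
    of a tensor gives D (A_n X) = A_(n+1) X + A_n (D X) plus two terms that
    contain D gamma', and these vanish since gamma is a geodesic
    ([cov_jacobi]).  So D acts on the expressions A_m (D^i X) as the sum of two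
    commuting shifts, one of m and one of i, and the binomial theorem expands
    D^n (A_0 X) as the sum over i of binomial(n, i) A_(n-i) (D^i X)
    ([iter_cov_jacobi]).  Solving for the term i = 0 is the claim.

    The work lies in giving a meaning to R^{n)}_t on a single tangent vector and
    in discarding the terms with D gamma': both require that the value of
    (nabla^n R)(X, Y)Z at t depends only on the values of X, Y and Z at t.  An
    operator that is linear over the smooth functions on J has this property
    ([function_linear_eq]), because a smooth field V along gamma with V(t) = 0
    has the form V(s) = (s - t) W(s) with W smooth ([smooth_along_divide]), and
    the factor s - t comes out of the operator and vanishes at t.  This
    division, a one-variable Hadamard lemma, needs no cut-off functions.
    Function linearity passes from a tensor to its covariant derivative, since
    the terms with f' in D (A (f X)) and A (D (f X)) cancel
    ([function_linear_commutator]).  At the start of the induction, the field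
    R(X, Y)Z is smooth along gamma because in a chart it is a combination, with
    smooth coefficients, of the values of R on the coordinate frame
    ([smooth_along_tensor]). *)

(** * Differential calculus of C^k maps *)

Section NearEq.
Context {R : realType} {V W : normedModType R}.
Implicit Types (f g : V -> W) (x : V).

Lemma near_eq_continuous f g x : (\near x, f x = g x) ->
  {for x, continuous f} -> {for x, continuous g}.
Proof.
move=> fg cf; have fgx : f x = g x := nbhs_singleton fg.
suff : g y @[y --> x] --> f x by rewrite fgx.
by apply: cvg_trans cf; exact: near_eq_cvg.
Qed.

Lemma near_eq_differentiable f g x : (\near x, f x = g x) ->
  differentiable f x -> differentiable g x.
Proof.
move=> fg df.
have [cdf /eqaddoP fo] : continuous ('d f x) /\
    f \o shift x = cst (f x) + 'd f x +o_ 0 id.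
  by apply/diff_locallyP.
have go : g \o shift x = cst (g x) + 'd f x +o_ 0 id.
  apply/eqaddoP => e e0; have := fo e e0.
  have fg0 : \forall y \near (0 : V), f (y + x) = g (y + x).
    move: fg; rewrite (near_shift 0 x); apply: filterS => y.
    by rewrite /= subr0.
  apply: filterS2 fg0 => y fgy.
  have fgx : f x = g x := nbhs_singleton fg.
  by rewrite /= !fctE /= fgy fgx.
by apply/diff_locallyP; rewrite (diff_unique cdf go).
Qed.

End NearEq.

Section CkCalculus.
Context {R : realType} {V W : normedModType R}.
Implicit Types (f g : V -> W) (U : set V).

Lemma Ck_sub k U U' f : U' `<=` U -> Ck k U f -> Ck k U' f.
Proof.
elim: k f => [|k IH] f UU' /=; first by move=> cf x /UU'/cf.
by move=> [df Df]; split=> [x /UU'/df//|v]; exact: IH.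
Qed.

Lemma Ck_eq k U f g : open U -> {in U, f =1 g} -> Ck k U f -> Ck k U g.
Proof.
move=> oU; have near_fg h1 h2 x : {in U, h1 =1 h2} -> U x ->
    \near x, h1 x = h2 x :> W.
  move=> h12 Ux; have : \forall y \near x, U y by exact: open_nbhs_nbhs.
  by apply: filterS => y Uy; apply: h12; rewrite inE.
elim: k f g => [|k IH] f g fg /=.
  by move=> cf x Ux; apply: near_eq_continuous (cf x Ux); exact: near_fg.
move=> [df Df]; split=> [x Ux|v].
  by apply: near_eq_differentiable (df x Ux); exact: near_fg.
apply: IH (Df v) => x; rewrite inE => Ux.
by apply: near_eq_derive; exact: near_fg.
Qed.

Lemma CkS k U f : Ck k.+1 U f -> Ck k U f.
Proof.
elim: k f => [|k IH] f [df Df].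
  by move=> x Ux; exact/differentiable_continuous/df.
by split=> // v; exact/IH.
Qed.

Lemma Ck_cst k U (a : W) : Ck k U (cst a).
Proof.
elim: k a => [|k IH] a /=; first by move=> x _; exact: cst_continuous.
split=> [x _|v]; first exact: differentiable_cst.
by rewrite (_ : 'D_v _ = cst 0)//; apply/funext => x; exact: derive_cst.
Qed.

Lemma Ck_add k U f g : open U -> Ck k U f -> Ck k U g ->
  Ck k U (fun x => f x + g x).
Proof.
move=> oU; elim: k f g => [|k IH] f g /=.
  by move=> cf cg x Ux; apply: cvgD; [exact: cf|exact: cg].
move=> [df Df] [dg Dg]; split=> [x Ux|v].
  by apply: differentiableD; [exact: df|exact: dg].
apply: Ck_eq (IH _ _ (Df v) (Dg v)) => // x; rewrite inE => Ux.
by rewrite /= deriveD//; apply: diff_derivable; [exact: df|exact: dg].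
Qed.

Lemma Ck_sum k U n (h : 'I_n -> V -> W) : open U -> (forall i, Ck k U (h i)) ->
  Ck k U (fun x => \sum_i h i x).
Proof.
move=> oU; elim: n h => [|n IH] h Ch.
  by under eq_fun do rewrite big_ord0; exact: (Ck_cst _ _ 0).
under eq_fun do rewrite big_ord_recr /=.
by apply: Ck_add => //; exact: IH.
Qed.

End CkCalculus.

(** The differential of the pointwise product f *: g comes from the bilinearity
    of scaling, which makes one product rule cover real and vector values. *)
Section CkScale.
Context {R : realType} {V W : normedModType R}.
Implicit Types (g : V -> W) (U : set V).

Lemma scale_is_bilinear : bilinear_for
    (GRing.Scale.Law.clone _ _ *:%R _) (GRing.Scale.Law.clone _ _ *:%R _)
    (@GRing.scale R W).
Proof.
split=> [u'|u] a x y /=; first by rewrite scalerDl scalerA.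
by rewrite scalerDr !scalerA mulrC.
Qed.

Lemma is_diff_scale (f : V -> R) g x :
  differentiable f x -> differentiable g x ->
  is_diff x (fun y => f y *: g y) (fun v => f x *: 'd g x v + 'd f x v *: g x).
Proof.
move=> df dg.
pose bM := bilinear_isBilinear.Build R R W W _ _ _ scale_is_bilinear.
pose b : {bilinear R -> W -> W} := HB.pack (@GRing.scale R W) bM.
have bc : continuous (fun p => b p.1 p.2) by move=> p; exact: scale_continuous.
have -> : (fun y => f y *: g y) =
  (fun p => b p.1 p.2) \o (fun y => (f y, g y)) by [].
have dp := differentiable_pair df dg.
have db := differentiable_bilin (f x, g x) bc.
apply: DiffDef; first exact: differentiable_comp.
by rewrite diff_comp // diff_bilin // diff_pair.
Qed.

Lemma Ck_scale k U (f : V -> R) g : open U -> Ck k U f -> Ck k U g ->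
  Ck k U (fun x => f x *: g x).
Proof.
move=> oU; elim: k f g => [|k IH] f g.
  by move=> cf cg x Ux; apply: cvgZ; [exact: cf|exact: cg].
move=> Cf Cg; have [[df Df] [dg Dg]] := (Cf, Cg); split=> [x Ux|v].
  by have [] := is_diff_scale (df x Ux) (dg x Ux).
apply: (@Ck_eq _ _ _ _ _ (fun x => f x *: 'D_v g x + 'D_v f x *: g x)) => //.
  move=> x; rewrite inE => Ux.
  have [dfg] := is_diff_scale (df x Ux) (dg x Ux).
  move=> /(congr1 (@^~ v)); rewrite -deriveE// => ->.
  by rewrite !deriveE//; [exact: df|exact: dg].
by apply: Ck_add => //; apply: IH; [exact: CkS|exact: Dg|exact: Df|exact: CkS].
Qed.

End CkScale.

(** The point y is kept apart from f x so that the rule applies when f x is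
    only provably equal to the given form of y, as for changes of charts. *)
Lemma derive_comp_at (R : realType) (U V W : normedModType R) (f : U -> V)
    (g : V -> W) (x : U) (y : V) (v : U) : f x = y ->
  differentiable f x -> differentiable g y ->
  'D_v (g \o f) x = 'd g y ('d f x v).
Proof.
move=> <- df dg; rewrite (deriveE v (differentiable_comp df dg)).
by rewrite (diff_comp df dg).
Qed.

Section CkCoordinates.
Context {R : realType} {V : normedModType R} {d : nat}.
Implicit Types (f : V -> 'rV[R]_d) (U : set V).

Lemma Ck_coord k U f j : open U -> Ck k U f -> Ck k U (fun x => f x 0 j).
Proof.
move=> oU; elim: k f => [|k IH] f /=.
  move=> cf x Ux; apply: (@continuous_comp _ _ _ f (fun N : 'rV_d => N 0 j)).
    exact: cf.
  exact: coord_continuous.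
move=> [df Df]; split=> [x Ux|v].
  apply: (@differentiable_comp _ _ _ _ f (fun N : 'rV_d => N 0 j)).
    exact: df.
  exact: differentiable_coord.
apply: Ck_eq (IH _ (Df v)) => // x; rewrite inE => Ux.
by rewrite derive_mx ?mxE//; exact/diff_derivable/df.
Qed.

Lemma Ck_row k U f : open U -> (forall j, Ck k U (fun x => f x 0 j)) ->
  Ck k U f.
Proof.
move=> oU Cf.
apply: (@Ck_eq _ _ _ _ _ (fun x => \sum_j f x 0 j *: delta_mx 0 j)) => //.
  by move=> x _ /=; rewrite [RHS]row_sum_delta.
by apply: Ck_sum => // j; apply: Ck_scale => //; exact: Ck_cst.
Qed.

(** Expanding the inner derivative in the standard basis leaves directional
    derivatives of g in fixed directions, the only ones that [Ck] speaks of. *)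
Lemma derive_comp_coord (W : normedModType R) f (g : 'rV[R]_d -> W) x v :
  differentiable f x -> differentiable g (f x) ->
  'D_v (g \o f) x = \sum_j ('D_v f x) 0 j *: 'D_(delta_mx 0 j) g (f x).
Proof.
move=> df dg; have -> : 'D_v (g \o f) x = 'd g (f x) ('D_v f x).
  by rewrite (deriveE v df); exact: derive_comp_at.
rewrite {1}['D_v f x]row_sum_delta linear_sum.
by apply: eq_bigr => j _; rewrite linearZ (deriveE _ dg).
Qed.

Lemma Ck_comp (W : normedModType R) k U f (U' : set 'rV[R]_d)
    (g : 'rV[R]_d -> W) :
  open U -> open U' -> f @` U `<=` U' -> Ck k U f -> Ck k U' g ->
  Ck k U (g \o f).
Proof.
move=> oU oU' fU; have U'f x : U x -> U' (f x) by move=> Ux; apply: fU; exists x.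
elim: k g => [|k IH] g.
  by move=> cf cg x Ux; apply: continuous_comp; [exact: cf|exact/cg/U'f].
move=> Cf [dg Dg]; have [df Df] := Cf; split=> [x Ux|v].
  by apply: differentiable_comp; [exact: df|exact/dg/U'f].
apply: (@Ck_eq _ _ _ _ _
  (fun x => \sum_j ('D_v f x) 0 j *: ('D_(delta_mx 0 j) g \o f) x)) => //.
  move=> x; rewrite inE => Ux /=.
  by rewrite derive_comp_coord//; [exact: df|exact/dg/U'f].
apply: Ck_sum => // j; apply: Ck_scale => //.
  exact: Ck_coord oU (Df v).
by apply: IH; [exact: CkS|exact: Dg].
Qed.

End CkCoordinates.

(** * Division of a smooth function by its zero *)

Section Hadamard.
Context {R : realType}.
Implicit Types (f g u : R -> R) (U : set R).

Lemma mean_value_between f (df : R -> R) (x y : R) :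
  (forall z, Num.min x y < z < Num.max x y -> is_derive z 1 f (df z)) ->
  (forall z, Num.min x y <= z <= Num.max x y -> {for z, continuous f}) ->
  exists2 z, Num.min x y < z < Num.max x y \/ y = x & f y - f x = df z * (y - x).
Proof.
have cts a b : (forall z, a <= z <= b -> {for z, continuous f}) ->
    {within `[a, b], continuous f}.
  move=> cf; apply/continuous_in_subspaceT => z; rewrite inE/= in_itv.
  exact: cf.
case: (ltgtP x y) => [xy|yx|->] df' /cts cf.
- have {}df' z : z \in `]x, y[ -> is_derive z 1 f (df z).
    by rewrite in_itv; exact: df'.
  have [z] := MVT xy df' cf.
  by rewrite in_itv => zxy ->; exists z => //; left.
- have {}df' z : z \in `]y, x[ -> is_derive z 1 f (df z).
    by rewrite in_itv; exact: df'.
  have [z] := MVT yx df' cf.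
  rewrite in_itv => zxy E; exists z; first by left.
  by rewrite -opprB E -mulrN opprB.
- by exists y; [right|rewrite !subrr mulr0].
Qed.

Lemma is_derive1P f (t c : R) : is_derive t 1 f c <->
  forall e : R, 0 < e ->
    \forall s \near t, `|f s - f t - c * (s - t)| <= e * `|s - t|.
Proof.
have E (e : R) : (\forall h \near 0,
      h != 0 -> `|c - h^-1 *: (f (h *: 1 + t) - f t)| <= e) <->
    (\forall s \near t, `|f s - f t - c * (s - t)| <= e * `|s - t|).
  rewrite (near_shift 0 t).
  have mulh (h : R) : h != 0 -> `|f (h + t) - f t - c * h| =
      `|c - h^-1 *: (f (h *: 1 + t) - f t)| * `|h|.
    move=> h0; rewrite -normrM [h *: 1]mulr1 distrC; congr `|_|.
    by rewrite -[_^-1 *: _]/(_^-1 * _); field.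
  split; apply: filterS => h; rewrite /= subr0 addrK.
    have [->|h0 /(_ isT) he] := eqVneq h 0.
      by rewrite mulr0 add0r !subrr normr0 mulr0.
    by rewrite mulh// ler_pM2r// normr_gt0.
  by move=> he h0; rewrite mulh// ler_pM2r ?normr_gt0 in he.
split=> [[df dfc] e e0|fc].
  subst c; apply: (E e).1; move/cvgrPdist_le : df => /(_ e e0).
  by rewrite near_withinE.
suff ucvg : (fun h => h^-1 *: (f (h *: 1 + t) - f t)) h @[h --> 0^'] --> c.
  by split; [apply/cvg_ex; exists c|exact/cvg_lim].
by apply/cvgrPdist_le => e e0; rewrite near_withinE; exact/(E e).2/fc.
Qed.

(** A continuous solution of the singular equation (s - t) u' + a u = g is
    differentiable at the singular point t: subtract from u its would-be
    first-order expansion at t, giving w; the product (s - t)^a w has a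
    derivative that is small compared with (s - t)^a, so by the mean value
    theorem w is small compared with s - t.  The value of u'(t) is forced by
    differentiating the equation at t. *)
Lemma singular_ode_derivable (a : nat) (t : R) g u (g' : R := 'D_1 g t) :
  (\forall s \near t, s != t ->
     is_derive s 1 u ((s - t)^-1 * (g s - a%:R * u s))) ->
  {for t, continuous u} -> a%:R * u t = g t -> derivable g t 1 ->
  is_derive t 1 u (g' / a.+1%:R).
Proof.
move=> du cu ug dg; apply/is_derive1P => e e0.
have /is_derive1P/(_ e e0) gE : is_derive t 1 g g' by split.
set c : R := g' / a.+1%:R.
have : \forall s \near t, (s != t ->
     is_derive s 1 u ((s - t)^-1 * (g s - a%:R * u s))) /\
    `|g s - g t - g' * (s - t)| <= e * `|s - t|.
  by near=> s; split; near: s.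
move=> /nbhs_ballP[r r0 rP]; apply/nbhs_ballP; exists r => // s ts.
move: (s : R) ts => {}s ts.
pose w (s : R) : R := u s - u t - c * (s - t).
pose v (s : R) : R := (s - t) ^+ a * w s.
pose dv (s : R) : R := (s - t) ^+ a * ((s - t)^-1 * (g s - g t - g' * (s - t))).
have between (z : R) : Num.min t s <= z <= Num.max t s -> ball t r z.
  move: ts; rewrite -ball_normE /= !ltr_distlC.
  by case: (leP t s) => ? /andP[? ?] /andP[? ?]; apply/andP; split; lra.
have dX (z : R) : is_derive z 1 (fun s : R => (s - t) ^+ a)
    (a%:R * (z - t) ^+ a.-1).
  have -> : (fun s : R => (s - t) ^+ a) = (id - cst t) ^+ a.
    by apply/funext => y; rewrite fctE.
  by apply: is_derive_eq; rewrite subr0 [_ *: _]mulr1.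
have dL (z : R) : is_derive z 1 (fun s : R => c * (s - t)) c.
  have -> : (fun s : R => c * (s - t)) = c *: (id - cst t).
    by apply/funext => y; rewrite fctE.
  by apply: is_derive_eq; rewrite subr0 [_ *: _]mulr1.
have vd (z : R) : Num.min t s < z < Num.max t s -> is_derive z 1 v (dv z).
  move=> zts; have zt : z != t.
    by case: (leP t s) zts => ? /andP[? ?]; apply/eqP => zt; lra.
  have [/(_ zt) du' _] : (z != t ->
     is_derive z 1 u ((z - t)^-1 * (g z - a%:R * u z))) /\
    `|g z - g t - g' * (z - t)| <= e * `|z - t|.
    by apply/rP/between; case/andP: zts => /ltW-> /ltW.
  have -> : v = (fun s : R => (s - t) ^+ a) *
      (u - cst (u t) - (fun s : R => c * (s - t))).
    by apply/funext => y.
  apply: is_derive_eq.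
  rewrite /dv subr0 -[LHS]/(_ * _ + _ * _) !fctE.
  have zt0 : z - t != 0 by rewrite subr_eq0.
  have a0 : a.+1%:R != 0 :> R by rewrite pnatr_eq0.
  (* The truncated exponent is harmless: for a = 0 both sides are 0. *)
  have -> : a%:R * (z - t) ^+ a.-1 = a%:R * ((z - t)^-1 * (z - t) ^+ a).
    by case: (a) => [|b] /=; rewrite ?mul0r// exprS mulKf.
  have cE : g' = c * (a%:R + 1) by rewrite natr1 divfK.
  by rewrite -ug cE; field.
have cv (z : R) : Num.min t s <= z <= Num.max t s -> {for z, continuous v}.
  move=> /between /rP [du' _].
  have cuz : {for z, continuous u}.
    have [->//|/du' [+ _]] := eqVneq z t.
    by move=> /derivable1_diffP/differentiable_continuous.
  have dcts f (l : R) : is_derive z 1 f l -> {for z, continuous f}.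
    by move=> [/derivable1_diffP/differentiable_continuous].
  apply: cvgM; first exact: dcts (dX z).
  apply: cvgB; last exact: dcts (dL z).
  by apply: cvgB => //; exact: cvg_cst.
have [z zs vE] := mean_value_between vd cv.
have [->|st] := eqVneq s t; first by rewrite !subrr mulr0 subrr normr0 mulr0.
have {}st0 : 0 < `|s - t| by rewrite normr_gt0 subr_eq0.
have {}zs : Num.min t s < z < Num.max t s.
  by case: zs => // st1; move: st; rewrite st1 eqxx.
have zt0 : 0 < `|z - t|.
  rewrite normr_gt0 subr_eq0; apply/eqP => zt.
  by case: (leP t s) zs => ? /andP[? ?]; lra.
have zts : `|z - t| <= `|s - t|.
  case: (leP t s) zs => ? /andP[? ?].
    by rewrite !ger0_norm; lra.
  by rewrite !ler0_norm; lra.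
have [_ gz] : (z != t ->
     is_derive z 1 u ((z - t)^-1 * (g z - a%:R * u z))) /\
    `|g z - g t - g' * (z - t)| <= e * `|z - t|.
  by apply/rP/between; case/andP: zs => /ltW-> /ltW.
have w0 : v t = 0 by rewrite /v /w !subrr mulr0 subrr mulr0.
have sa0 : 0 < `|s - t| ^+ a by rewrite exprn_gt0.
rewrite -(ler_pM2l sa0) -{1}normrX -normrM -[_ * _]/(v s).
rewrite -[v s]subr0 -w0 vE /dv !normrM normrX normfV.
rewrite [leRHS]mulrA ler_pM2r//.
apply: ler_pM; rewrite ?exprn_ge0 ?mulr_ge0 ?invr_ge0//.
  by rewrite lerXn2r ?nnegrE.
by rewrite ler_pdivrMl// [leRHS]mulrC.
Unshelve. all: by end_near. Qed.

Lemma is_derive_shift_inv (s t : R) : s - t != 0 ->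
  is_derive s 1 (fun y => (y - t)^-1) (- (s - t)^-2).
Proof.
move=> st; have dtE : is_derive s 1 (fun y : R => y - t) 1.
  have -> : (fun y => y - t) = id - cst t by apply/funext.
  by apply: is_derive_eq; rewrite subr0.
by apply: is_derive_eq; rewrite [LHS]mulr1.
Qed.

(** The class of these solutions is closed under differentiation: if
    (s - t) u' + a u = g, then u' solves the same equation with a + 1 and g'.
    Hence one differentiability result gives all orders. *)
Lemma Ck_singular_ode k (a : nat) (t : R) U g u : open U -> smooth_on U g ->
  (forall s, U s -> s != t ->
     is_derive s 1 u ((s - t)^-1 * (g s - a%:R * u s))) ->
  (U t -> {for t, continuous u} /\ a%:R * u t = g t) ->
  Ck k U u.
Proof.
move=> oU; elim: k a g u => [|k IH] a g u Cg du ut.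
  move=> x Ux; have [xt|xt] := eqVneq x t; first by case: ut; rewrite -?xt.
  by have [/derivable1_diffP/differentiable_continuous] := du x Ux xt.
have dg s : U s -> derivable g s 1.
  by move=> Us; have [dg _] := Cg 1%N; exact/derivable1_diffP/dg.
have near_du s : U s -> \forall y \near s, y != t ->
    is_derive y 1 u ((y - t)^-1 * (g y - a%:R * u y)).
  move=> Us; have : \forall y \near s, U y by exact: open_nbhs_nbhs.
  by apply: filterS => y Uy; exact: du.
have dut : U t -> is_derive t 1 u ('D_1 g t / a.+1%:R).
  move=> Ut; have [cu gt] := ut Ut.
  by apply: singular_ode_derivable => //; [exact: near_du|exact: dg].
have du1 s : U s -> differentiable u s.
  move=> Us; apply/derivable1_diffP; have [st|st] := eqVneq s t.
    by rewrite st in Us *; have [] := dut Us.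
  by have [] := du s Us st.
split=> // v.
apply: (@Ck_eq _ _ _ _ _ (fun s => v *: 'D_1 u s)) => //.
  move=> s; rewrite inE => Us.
  have dus := du1 s Us; rewrite !(deriveE _ dus).
  by rewrite -[X in _ = 'd u s X](mulr1 v) -[v * 1]/(v *: 1) linearZ.
apply: Ck_scale => //; first exact: Ck_cst.
apply: (IH a.+1 ('D_1 g)).
- by move=> j; have [_] := Cg j.+1; apply.
- move=> s Us st; have s0 : s - t != 0 by rewrite subr_eq0.
  have [us Dus] := du s Us st; have gs := dg s Us.
  have st_near : \forall y \near s, y != t.
    by apply: open_nbhs_nbhs; split=> //; exact: open_neq.
  have uE : \forall y \near s,
      (fun y => (y - t)^-1 * (g y - a%:R * u y)) y = 'D_1 u y.
    near=> y; have yt : y != t by near: y.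
    suff [_ ->] : is_derive y 1 u ((y - t)^-1 * (g y - a%:R * u y)) by [].
    by move: yt; near: y; exact: near_du.
  apply: near_eq_is_derive uE _.
  have dV := is_derive_shift_inv s0.
  have -> : (fun y => (y - t)^-1 * (g y - a%:R * u y)) =
      (fun y => (y - t)^-1) * (g - a%:R *: u) by apply/funext.
  have dgu : is_derive s 1 (g - a%:R *: u) ('D_1 g s - a%:R *: 'D_1 u s).
    by apply: is_deriveB; [|apply: is_deriveZ]; exact: derivableP.
  apply: is_derive_eq (is_deriveM dV dgu) _.
  rewrite Dus -![_ *: _]/(_ * _) !fctE -natr1.
  by rewrite -![_ *: _]/(_ * _); field.
- move=> Ut; have [du_t Du_t] := dut Ut; have gut := (ut Ut).2.
  split; last first.
    by rewrite Du_t mulrC divfK ?pnatr_eq0.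
  have a0 : 0 < a.+1%:R :> R by rewrite ltr0n.
  apply/cvgrPdist_le => e e0; have e1 : 0 < e / a.+1%:R by rewrite divr_gt0.
  have /is_derive1P/(_ _ e1) gE : is_derive t 1 g ('D_1 g t).
    by apply: DeriveDef => //; exact: dg.
  have /is_derive1P/(_ _ e1) uE := dut Ut.
  have duE := near_du t Ut.
  apply: filterS3 duE gE uE => y duE gE uE.
  have [->|yt] := eqVneq y t; first by rewrite subrr normr0 ltW.
  have [_ ->] := duE yt.
  have yt0 : y - t != 0 by rewrite subr_eq0.
  have yt1 : 0 < `|y - t| by rewrite normr_gt0.
  rewrite Du_t -(ler_pM2r yt1) -normrM mulrBl distrC.
  have -> : (y - t)^-1 * (g y - a%:R * u y) * (y - t)
      - 'D_1 g t / a.+1%:R * (y - t) = (g y - g t - 'D_1 g t * (y - t))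
        - a%:R * (u y - u t - 'D_1 g t / a.+1%:R * (y - t)).
    by rewrite -gut -natr1; field; rewrite natr1 gt_eqF.
  rewrite (le_trans (ler_normB _ _))// normrM normr_nat.
  have -> : e * `|y - t| = e / a.+1%:R * `|y - t|
      + a%:R * (e / a.+1%:R * `|y - t|).
    by rewrite -natr1; field; rewrite natr1 gt_eqF.
  by rewrite lerD// ler_wpM2l.
Unshelve. all: by end_near. Qed.

(** Hadamard's lemma on the line: the quotient u = f / (s - t) solves
    (s - t) u' + u = f'. *)
Lemma smooth_on_difference_quotient (t : R) U f : open U -> smooth_on U f ->
  (U t -> f t = 0) ->
  smooth_on U (fun s => if s == t then 'D_1 f t else (s - t)^-1 * f s).
Proof.
move=> oU Cf ft k; set u := fun s => _.
have df s : U s -> is_derive s 1 f ('D_1 f s).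
  move=> Us; apply: derivableP.
  by have [df _] := Cf 1%N; exact/derivable1_diffP/df.
have uE (s : R) : s != t -> \forall y \near s, (y - t)^-1 * f y = u y.
  move=> st; have : \forall y \near s, y != t.
    by apply: open_nbhs_nbhs; split=> //; exact: open_neq.
  by apply: filterS => y yt; rewrite /u (negbTE yt).
apply: (@Ck_singular_ode k 1 t U ('D_1 f)) => //.
- by move=> j; have [_] := Cf j.+1; apply.
- move=> s Us st; apply: near_eq_is_derive (uE s st) _.
  have s0 : s - t != 0 by rewrite subr_eq0.
  have dV := is_derive_shift_inv s0.
  have -> : (fun y => (y - t)^-1 * f y) = (fun y => (y - t)^-1) * f.
    by apply/funext.
  apply: is_derive_eq (is_deriveM dV (df s Us)) _.
  rewrite /u (negbTE st) -![_ *: _]/(_ * _).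
  by field.
- move=> Ut; rewrite /u eqxx mul1r; split=> //.
  apply/cvgrPdist_le => e e0; rewrite eqxx.
  have /is_derive1P/(_ _ e0) := df t Ut.
  apply: filterS => y; rewrite ft// subr0 => fy.
  have [_|yt] := eqVneq y t; first by rewrite subrr normr0 ltW.
  have yt0 : y - t != 0 by rewrite subr_eq0.
  have yt1 : 0 < `|y - t| by rewrite normr_gt0.
  rewrite -(ler_pM2r yt1) -normrM mulrBl distrC; apply: le_trans fy.
  by rewrite le_eqVlt; apply/orP; left; apply/eqP; congr `|_|; field.
Qed.

End Hadamard.

Lemma smooth_on_difference_quotient_row (R : realType) (d : nat) (t : R)
    (U : set R) (f : R -> 'rV[R]_d) : open U -> smooth_on U f ->
  (U t -> f t = 0) ->
  smooth_on U (fun s => if s == t then 'D_1 f t else (s - t)^-1 *: f s).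
Proof.
move=> oU Cf ft k; apply: Ck_row => // j.
have Cfj : smooth_on U (fun s => f s 0 j) by move=> i; exact: Ck_coord.
have ftj : U t -> f t 0 j = 0 by move=> /ft ->; rewrite mxE.
apply: Ck_eq (smooth_on_difference_quotient oU Cfj ftj k) => // s.
rewrite inE => Us; case: eqP => [st|_]; last by rewrite mxE.
rewrite derive_mx ?mxE//; apply: diff_derivable.
by have [df _] := Cf 1%N; apply: df; rewrite -st.
Qed.

(** * Charts and coordinate vector fields *)

Section Charts.
Context {R : realType} {d : nat} {M : manifold R d}.
Implicit Types (p : M) (c : cidx M) (v : 'rV[R]_d).

Lemma open_chart_image c (A : set M) : open A -> open (cmap c @` (A `&` cdom c)).
Proof.
move=> oA; rewrite openE => _ [p [Ap cp] <-]; rewrite /interior.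
have ip : (cmap c @` cdom c) (cmap c p) by exists p.
have cvp : cinv c x @[x --> cmap c p] --> p.
  by have := cinv_continuous ip; rewrite -[X in _ --> X](cmapK cp).
have Ainv : \forall x \near cmap c p, A (cinv c x).
  by apply: cvp; exact: open_nbhs_nbhs.
have cimg : \forall x \near cmap c p, (cmap c @` cdom c) x.
  by apply: open_nbhs_nbhs; split=> //; exact: cimg_open.
apply: filterS2 Ainv cimg => x Ax [q cq qx].
by exists q => //; split=> //; move: Ax; rewrite -qx cmapK.
Qed.

Definition transition c c' : 'rV[R]_d -> 'rV[R]_d := cmap c' \o cinv c.

Definition overlap c c' : set 'rV[R]_d := cmap c @` (cdom c `&` cdom c').

Lemma open_overlap c c' : open (overlap c c').
Proof. by rewrite /overlap setIC; exact/open_chart_image/cdom_open. Qed.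

Lemma smooth_transition c c' : smooth_on (overlap c c') (transition c c').
Proof. by have [] := ctransition c c'. Qed.

Lemma transition_overlap c c' :
  transition c c' @` overlap c c' `<=` overlap c' c.
Proof.
by move=> _ [_ [p [cp c'p] <-] <-]; exists p => //=; rewrite /transition/= cmapK.
Qed.

Lemma near_overlap c c' p : cdom c p -> cdom c' p ->
  \forall x \near cmap c p, overlap c c' x.
Proof.
move=> cp c'p; apply: open_nbhs_nbhs; split; first exact: open_overlap.
by exists p.
Qed.

Lemma differentiable_transition c c' p : cdom c p -> cdom c' p ->
  differentiable (transition c c') (cmap c p).
Proof.
move=> cp c'p; have [df _] := @smooth_transition c c' 1%N.
by apply: df; exists p.
Qed.

Lemma diff_transition_id c p v : cdom c p -> 'd (transition c c) (cmap c p) v = v.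
Proof.
move=> cp; rewrite -deriveE; last exact: differentiable_transition.
rewrite -[RHS](derive_id (cmap c p) v); apply: near_eq_derive.
apply: filterS (near_overlap cp cp) => _ [q [cq _] <-].
by rewrite /transition/= cmapK.
Qed.

Lemma diff_transition_comp c c' c'' p v :
  cdom c p -> cdom c' p -> cdom c'' p ->
  'd (transition c c'') (cmap c p) v =
  'd (transition c' c'') (cmap c' p) ('d (transition c c') (cmap c p) v).
Proof.
move=> cp c'p c''p.
have tp : transition c c' (cmap c p) = cmap c' p.
  by rewrite /transition/= cmapK.
have dt := differentiable_transition cp c'p.
have dt' := differentiable_transition c'p c''p.
apply: etrans (derive_comp_at v tp dt dt').
apply: etrans (esym (deriveE v (differentiable_transition cp c''p))) _.
apply: near_eq_derive; apply: filterS (near_overlap cp c'p) => _ [q [cq c'q] <-].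
by rewrite /transition/= !cmapK.
Qed.

(** The coordinates, in every chart, of the tangent vector at p whose coordinate
    vector in the chart c is v. *)
Definition chart_vector_coord c p v c' : 'rV[R]_d :=
  if `[< cdom c p /\ cdom c' p >] then 'd (transition c c') (cmap c p) v else 0.

Fact chart_vector_subproof c p v :
  chart_vector_coord c p v \in @tangent_pred _ _ M p.
Proof.
apply/asboolP; rewrite /chart_vector_coord; split=> [c' c'p|c' c'' c'p c''p].
  by case: asboolP => // -[].
have [cp|ncp] := pselect (cdom c p).
  by rewrite !asboolT//; exact: diff_transition_comp.
by rewrite !asboolF ?linear0//; case.
Qed.

Definition chart_vector c p v : tangent p := Tangent (chart_vector_subproof c p v).

Lemma chart_vectorE c c' p v : cdom c p -> cdom c' p ->
  chart_vector c p v c' = 'd (transition c c') (cmap c p) v.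
Proof. by move=> cp c'p; rewrite /= /chart_vector_coord asboolT. Qed.

Lemma chart_vector_id c p v : cdom c p -> chart_vector c p v c = v.
Proof. by move=> cp; rewrite chart_vectorE// diff_transition_id. Qed.

Lemma tangentP p (u : tangent p) : is_tangent p u.
Proof. exact/asboolP/(valP u). Qed.

Lemma tangent_eq c p (u v : tangent p) : cdom c p -> u c = v c -> u = v.
Proof.
move=> cp uv; apply/val_inj/funext => c' /=.
have [[u0 uE] [v0 vE]] := (tangentP u, tangentP v).
have [c'p|nc'p] := pselect (cdom c' p); last by rewrite u0// v0.
by rewrite (uE c)// (vE c)// uv.
Qed.

Lemma tcoord0 p c : (0 : tangent p) c = 0.
Proof. exact: (congr1 (@^~ c) (raddf0 (\val : tangent p -> _))). Qed.

Lemma tcoordD p c (u v : tangent p) : (u + v) c = u c + v c.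
Proof. exact: (congr1 (@^~ c) (raddfD (\val : tangent p -> _) u v)). Qed.

Lemma tcoordZ p c (a : R) (u : tangent p) : (a *: u) c = a *: u c.
Proof. exact: (congr1 (@^~ c) (linearZZ (\val : tangent p -> _) a u)). Qed.

Lemma tcoord_sum p c n (u : 'I_n -> tangent p) :
  (\sum_i u i) c = \sum_i u i c.
Proof.
apply: (big_morph (fun w : tangent p => w c)); last exact: tcoord0.
by move=> ? ?; exact: tcoordD.
Qed.

Lemma tangent_frame c p (u : tangent p) : cdom c p ->
  u = \sum_i u c 0 i *: chart_vector c p (delta_mx 0 i).
Proof.
move=> cp; apply: (tangent_eq cp); rewrite tcoord_sum [LHS]row_sum_delta.
by apply: eq_bigr => i _; rewrite tcoordZ chart_vector_id.
Qed.

(** Read in another chart c', the coordinate field of c is a directional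
    derivative of the transition map from c to c', precomposed with the
    transition map back from c' to c. *)
Lemma smooth_chart_vector c v :
  smooth_field (cdom c) (fun p => chart_vector c p v).
Proof.
move=> c' k; rewrite setIC -/(overlap c' c).
apply: (@Ck_eq _ _ _ _ _ ('D_v (transition c c') \o transition c' c)).
- exact: open_overlap.
- move=> x; rewrite inE => -[p [c'p cp] <-].
  rewrite /transition/= cmapK// -/(transition c c').
  by rewrite deriveE; [rewrite -chart_vectorE|exact: differentiable_transition].
- apply: (@Ck_comp _ _ _ _ k _ _ (overlap c c'));
    [exact: open_overlap|exact: open_overlap| | |].
  + exact: transition_overlap.
  + exact: smooth_transition.
  + by have [_] := @smooth_transition c c' k.+1; apply.
Qed.

End Charts.

(** * Smooth fields along a curve *)

Section Along.
Context {R : realType} {d : nat} {M : manifold R d}.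
Variables (J : set R) (J_open : open J) (gamma : R -> M).
Hypothesis gamma_smooth : smooth_curve J gamma.
Implicit Types (X Y Z V W : along gamma) (c : cidx M) (t s : R) (f : R -> R).

Definition chart_times c : set R := J `&` gamma @^-1` cdom c.

Lemma open_chart_times c : open (chart_times c).
Proof.
rewrite openE => t [Jt ct]; rewrite /interior.
have Jnear : \forall s \near t, J s by exact: open_nbhs_nbhs.
have cnear : \forall s \near t, cdom c (gamma s).
  apply: gamma_smooth.1 => //.
  by apply: open_nbhs_nbhs; split=> //; exact: cdom_open.
by apply: filterS2 Jnear cnear.
Qed.

Lemma near_chart_times c t : J t -> cdom c (gamma t) ->
  \forall s \near t, chart_times c s.
Proof.
by move=> Jt ct; apply: open_nbhs_nbhs; split; [exact: open_chart_times|].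
Qed.

Lemma smooth_chart_curve c : smooth_on (chart_times c) (cmap c \o gamma).
Proof. exact: gamma_smooth.2. Qed.

Lemma smooth_chart_comp (W : normedModType R) c (U : set M)
    (h : 'rV[R]_d -> W) : open U -> cdom c `<=` U ->
  smooth_on (cmap c @` (U `&` cdom c)) h ->
  smooth_on (chart_times c) (h \o (cmap c \o gamma)).
Proof.
move=> oU cU Ch k.
apply: (@Ck_comp _ _ _ _ k _ _ (cmap c @` (U `&` cdom c))).
- exact: open_chart_times.
- exact: open_chart_image.
- by move=> _ [s [Js cs] <-]; exists (gamma s) => //; split=> //; exact: cU.
- exact: smooth_chart_curve.
- exact: Ch.
Qed.

Lemma smooth_along_add X Y : smooth_along J X -> smooth_along J Y ->
  smooth_along J (fun s => X s + Y s).
Proof.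
move=> CX CY c k; under eq_fun do rewrite tcoordD.
by apply: Ck_add; [exact: open_chart_times|exact: CX|exact: CY].
Qed.

Lemma smooth_along_scale f X : smooth_on J f -> smooth_along J X ->
  smooth_along J (fun s => f s *: X s).
Proof.
move=> Cf CX c k; under eq_fun do rewrite tcoordZ.
apply: Ck_scale; [exact: open_chart_times| |exact: CX].
by apply: Ck_sub (Cf k) => s [].
Qed.

(** The derivatives of the curve read in the charts obey the transformation law
    of tangent vectors, so the choice in [velocity] is a choice among existing
    vectors. *)
Lemma velocity_coord c t : J t -> cdom c (gamma t) ->
  velocity gamma t c = 'D_1 (cmap c \o gamma) t.
Proof.
move=> Jt ct; rewrite /velocity.
set P := [set v | _]; suff [v Pv] : P !=set0.
  by rewrite (xgetPex 0 (ex_intro _ v Pv)) // derive1E.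
exists (chart_vector c (gamma t) ('D_1 (cmap c \o gamma) t)) => c' c't.
have dgamma c1 : cdom c1 (gamma t) -> differentiable (cmap c1 \o gamma) t.
  by move=> c1t; have [df _] := @smooth_chart_curve c1 1%N; apply: df.
rewrite chart_vectorE// derive1E.
have dt := differentiable_transition ct c't.
transitivity ('D_1 (transition c c' \o (cmap c \o gamma)) t).
  rewrite (deriveE _ (dgamma c ct)); apply: esym.
  exact: (derive_comp_at _ (erefl _) (dgamma c ct) dt).
apply: near_eq_derive; apply: filterS (near_chart_times Jt ct) => s [_ cs].
by rewrite /transition/= cmapK.
Qed.

Lemma smooth_velocity : smooth_along J (velocity gamma).
Proof.
move=> c k; have [_ /(_ 1) Ck1] := @smooth_chart_curve c k.+1.
apply: Ck_eq Ck1; first exact: open_chart_times.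
by move=> s; rewrite inE => -[Js cs]; rewrite velocity_coord.
Qed.

Lemma restrict_tensor_frame (T : tensor13 M) X Y Z c t : cdom c (gamma t) ->
  restrict_tensor T X Y Z t = \sum_i \sum_j \sum_k
    (X t c 0 i * (Y t c 0 j * Z t c 0 k)) *:
    T (gamma t) (chart_vector c (gamma t) (delta_mx 0 i))
      (chart_vector c (gamma t) (delta_mx 0 j))
      (chart_vector c (gamma t) (delta_mx 0 k)).
Proof.
move=> ct; rewrite /restrict_tensor.
have sum_lin (h : tangent (gamma t) -> tangent (gamma t))
    (u : 'I_d -> tangent (gamma t)) (a : 'I_d -> R) :
    (forall b x x', h (b *: x + x') = b *: h x + h x') ->
    h (\sum_i a i *: u i) = \sum_i a i *: h (u i).
  move=> hP; have h0 : h 0 = 0.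
    by have := hP (-1) 0 0; rewrite scaler0 addr0 scaleN1r addNr.
  elim: (index_enum _) => [|i l IH]; first by rewrite !big_nil.
  by rewrite !big_cons hP IH.
rewrite {1}(tangent_frame (X t) ct) (sum_lin (fun x => T _ x _ _)); last first.
  by move=> *; rewrite tensorP1.
apply: eq_bigr => i _.
rewrite {1}(tangent_frame (Y t) ct) (sum_lin (fun x => T _ _ x _)); last first.
  by move=> *; rewrite tensorP2.
rewrite scaler_sumr; apply: eq_bigr => j _.
rewrite {1}(tangent_frame (Z t) ct) (sum_lin (fun x => T _ _ _ x)); last first.
  by move=> *; rewrite tensorP3.
rewrite !scaler_sumr; apply: eq_bigr => k _.
by rewrite !scalerA mulrA.
Qed.

(** Expansion in the coordinate frame is what links [tensor_smooth], which
    speaks of fields on open subsets of M, to fields along the curve, which need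
    not extend to fields on M. *)
Lemma smooth_along_tensor (T : tensor13 M) X Y Z :
  smooth_along J X -> smooth_along J Y -> smooth_along J Z ->
  smooth_along J (restrict_tensor T X Y Z).
Proof.
move=> CX CY CZ c m; have oc := @open_chart_times c.
pose G i j k (q : M) : 'rV[R]_d :=
  T q (chart_vector c q (delta_mx 0 i)) (chart_vector c q (delta_mx 0 j))
      (chart_vector c q (delta_mx 0 k)) c.
apply: (@Ck_eq _ _ _ _ _ (fun s => \sum_i \sum_j \sum_k
   (X s c 0 i *: (Y s c 0 j *: Z s c 0 k)) *: (G i j k (gamma s)))) => //.
  move=> s; rewrite inE => -[Js cs]; rewrite (restrict_tensor_frame T X Y Z cs) tcoord_sum.
  apply: eq_bigr => i _; rewrite tcoord_sum; apply: eq_bigr => j _.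
  by rewrite tcoord_sum; apply: eq_bigr => k _; rewrite tcoordZ.
have coordC V i : smooth_along J V -> Ck m (chart_times c) (fun s => V s c 0 i).
  by move=> CV; apply: Ck_coord => //; exact: CV.
apply: Ck_sum => // i; apply: Ck_sum => // j; apply: Ck_sum => // k.
apply: Ck_scale => //.
  by do 2 (apply: Ck_scale => //; first exact: coordC); exact: coordC.
apply: (@Ck_eq _ _ _ _ _ (G i j k \o cinv c \o (cmap c \o gamma))) => //.
  by move=> s; rewrite inE => -[Js cs] /=; rewrite cmapK.
have CG : smooth_on (cmap c @` (cdom c `&` cdom c)) (G i j k \o cinv c).
  have CE l := @smooth_chart_vector _ _ M c (delta_mx 0 l).
  exact: (tensor_smooth T (cdom_open c) (CE i) (CE j) (CE k)).
exact: (smooth_chart_comp (cdom_open c) (@subset_refl _ _) CG).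
Qed.

(** The quotient W is formed in each chart by Hadamard's lemma; at t its
    coordinates are the derivatives of those of V, and they transform like a
    tangent vector because the derivative of the transition law at t loses the
    term that contains V(t) = 0. *)
Lemma smooth_along_divide V t : smooth_along J V -> J t -> V t = 0 ->
  exists2 W : along gamma, smooth_along J W & V = (fun s => (s - t) *: W s).
Proof.
move=> CV Jt Vt; have [c0 c0t] := ccover (gamma t).
pose w0 := 'D_1 (fun s => V s c0) t.
exists (fun s => if s == t then chart_vector c0 (gamma s) w0
                 else (s - t)^-1 *: V s); last first.
  apply/functional_extensionality_dep => s; case: eqP => [->|/eqP st].
    by rewrite subrr scale0r.
  by rewrite scalerA mulfV ?scale1r// subr_eq0.
move=> c k; have oc := @open_chart_times c.
have Vct : chart_times c t -> V t c = 0 by move=> _; rewrite Vt tcoord0.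
apply: Ck_eq (smooth_on_difference_quotient_row oc (CV c) Vct k) => // s.
rewrite inE => -[Js cs]; case: eqP => [st|_]; last by rewrite tcoordZ.
rewrite st in cs Js *; rewrite chart_vectorE//.
pose gc0 := cmap c0 \o gamma.
have dgc0 : differentiable gc0 t.
  by have [df _] := @smooth_chart_curve c0 1%N; apply: df.
have dV0 : differentiable (fun r => V r c0) t.
  by have [df _] := CV c0 1%N; apply: df.
have dV0i i : differentiable (fun r => V r c0 0 i) t.
  apply: (@differentiable_comp _ _ _ _ (fun r => V r c0) (fun N => N 0 i)) => //.
  exact: differentiable_coord.
have dh i : differentiable ('D_(delta_mx 0 i) (transition c0 c) \o gc0) t.
  apply: differentiable_comp => //.
  have [_ /(_ (delta_mx 0 i)) [dD _]] := @smooth_transition _ _ _ c0 c 2%N.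
  by apply: dD; exists (gamma t).
transitivity ('D_1 (fun r => \sum_i V r c0 0 i *:
    'D_(delta_mx 0 i) (transition c0 c) (gc0 r)) t).
  apply: near_eq_derive.
  apply: filterS2 (near_chart_times Jt c0t) (near_chart_times Jt cs).
  move=> r [Jr c0r] [_ cr].
  have [_ VE] := tangentP (V r); rewrite (VE c0 c c0r cr).
  rewrite [X in 'd _ _ X]row_sum_delta linear_sum; apply: eq_bigr => i _.
  by rewrite linearZ deriveE//; exact: differentiable_transition.
pose term i r := V r c0 0 i *: 'D_(delta_mx 0 i) (transition c0 c) (gc0 r).
have dterm i : is_diff t (term i) _ := is_diff_scale (dV0i i) (dh i).
have -> : (fun r => \sum_i V r c0 0 i *:
    'D_(delta_mx 0 i) (transition c0 c) (gc0 r)) = \sum_i term i.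
  by apply/funext => r; rewrite fct_sumE.
rewrite derive_sum; last by move=> i; apply: diff_derivable; have [] := dterm i.
rewrite [X in _ = 'd _ _ X]row_sum_delta linear_sum; apply: eq_bigr => i _.
have [dti dtiE] := dterm i; rewrite linearZ (deriveE _ dti) dtiE Vt tcoord0 mxE.
rewrite scale0r add0r -(deriveE _ (dV0i i)).
rewrite -(deriveE _ (differentiable_transition c0t cs)) /w0.
by rewrite derive_mx ?mxE//; exact: diff_derivable.
Qed.

End Along.

(** * Tensoriality of covariant derivatives of tensors *)

(** Pascal's rule, summed against an arbitrary sequence. *)
Lemma sum_binomialS (V : nmodType) (n : nat) (F : nat -> V) :
  \sum_(i < n.+2) F i *+ 'C(n.+1, i) =
  \sum_(i < n.+1) F i *+ 'C(n, i) + \sum_(i < n.+1) F i.+1 *+ 'C(n, i).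
Proof.
rewrite big_ord_recl; under eq_bigr do rewrite /= /bump /= add1n binS mulrnDr.
rewrite big_split addrA; congr (_ + _).
rewrite [RHS]big_ord_recl big_ord_recr /= !bin0 bin_small// mulr0n addr0.
by congr (_ + _); apply: eq_bigr => i _; rewrite /bump /= add1n.
Qed.

Section Operators.
Context {R : realType} {d : nat} {M : manifold R d}.
Variables (J : set R) (J_open : open J) (gamma : R -> M).
Hypothesis gamma_smooth : smooth_curve J gamma.
Variables (nabla : vector_field M -> vector_field M -> vector_field M).
Variables (D : along gamma -> along gamma).
Hypothesis D_cov : covariant_derivative J nabla D.
Implicit Types (X Y Z V W : along gamma) (t s : R) (f : R -> R).
Implicit Types (A B : along gamma -> along gamma).

Let smoothD := smooth_along_add J_open gamma_smooth.
Let smoothZ := smooth_along_scale J_open gamma_smooth.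

Lemma smooth_on_derive1 f : smooth_on J f -> smooth_on J (f^`())%classic.
Proof.
move=> Cf k; have [_ /(_ 1) Cf1] := Cf k.+1.
by apply: Ck_eq Cf1 => // s _; rewrite derive1E.
Qed.

Lemma smooth_along_axpy f X Y : smooth_on J f -> smooth_along J X ->
  smooth_along J Y -> smooth_along J (fun s => f s *: X s + Y s).
Proof. by move=> Cf CX CY; apply: smoothD => //; exact: smoothZ. Qed.

Lemma smooth_along_sub X Y : smooth_along J X -> smooth_along J Y ->
  smooth_along J (fun s => X s - Y s).
Proof.
move=> CX CY.
have -> : (fun s => X s - Y s) = (fun s => (-1) *: Y s + X s).
  by apply/functional_extensionality_dep => s; rewrite scaleN1r addrC.
by apply: smooth_along_axpy => // k; exact: Ck_cst.
Qed.

Lemma smooth_along_zero : smooth_along J ((fun=> 0) : along gamma).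
Proof.
by move=> c k; under eq_fun do rewrite tcoord0; exact: (Ck_cst _ _ 0).
Qed.

Lemma cov_axpy f X Y t : smooth_on J f -> smooth_along J X ->
  smooth_along J Y -> J t ->
  D (fun s => f s *: X s + Y s) t =
  (f^`())%classic t *: X t + f t *: D X t + D Y t.
Proof.
move=> Cf CX CY Jt; rewrite (covD D_cov (smoothZ Cf CX) CY Jt).
by rewrite (covZ D_cov Cf CX Jt).
Qed.

(** If X and Y agree on J, then X - Y equals f (X - Y) for the function f that is
    0 on J and 1 elsewhere; f is smooth on J because J is open, and the Leibniz
    rule kills the difference.  This makes up for D being an operator on total
    functions of which only the restriction to J is meaningful. *)
Lemma cov_local X Y : smooth_along J X -> smooth_along J Y ->
  (forall s, J s -> X s = Y s) -> forall t, J t -> D X t = D Y t.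
Proof.
move=> CX CY XY t Jt.
pose f s : R := if `[< J s >] then 0 else 1.
have Cf : smooth_on J f.
  move=> k; apply: Ck_eq (Ck_cst k J (0 : R)) => // s.
  by rewrite inE => Js; rewrite /f asboolT.
have -> : X = fun s => f s *: (X s - Y s) + Y s.
  apply/functional_extensionality_dep => s; rewrite /f.
  case: asboolP => [/XY ->|_]; first by rewrite scale0r add0r.
  by rewrite scale1r subrK.
rewrite (cov_axpy Cf (smooth_along_sub CX CY) CY Jt) XY// subrr scaler0.
by rewrite /f asboolT// scale0r !add0r.
Qed.

(** Preservation of smoothness is part of the notion so that D can be applied
    to the result and the commutator with D is again of this kind. *)
Definition function_linear A : Prop :=
  (forall X, smooth_along J X -> smooth_along J (A X)) /\
  forall f X Y, smooth_on J f -> smooth_along J X -> smooth_along J Y ->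
    forall t, J t ->
      A (fun s => f s *: X s + Y s) t = f t *: A X t + A Y t.

(** Function-linear operators act pointwise: X - Y vanishes at t, so it is
    (s - t) W, and A takes it to (s - t) A W, which is 0 at t. *)
Lemma function_linear_eq A X Y t : function_linear A -> smooth_along J X ->
  smooth_along J Y -> J t -> X t = Y t -> A X t = A Y t.
Proof.
move=> [_ Alin] CX CY Jt XY.
have [|W CW XYE] := smooth_along_divide J_open gamma_smooth
    (smooth_along_sub CX CY) Jt.
  by rewrite XY subrr.
have -> : X = fun s => (s - t) *: W s + Y s.
  apply/functional_extensionality_dep => s.
  by have /(congr1 (@^~ s))/= <- := XYE; rewrite subrK.
rewrite Alin ?subrr ?scale0r ?add0r// => k.
apply: Ck_add => //; last exact: Ck_cst.
case: k => [|k]; first by move=> x _; exact: cvg_id.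
split=> [x _|v]; first exact: ex_diff.
rewrite (_ : 'D_v _ = cst v); first exact: Ck_cst.
by apply/funext => x; exact: derive_id.
Qed.

Lemma function_linear0 A X t : function_linear A -> smooth_along J X -> J t ->
  X t = 0 -> A X t = 0.
Proof.
move=> Alin CX Jt X0; have C0 := smooth_along_zero.
rewrite (function_linear_eq Alin CX C0 Jt X0).
have [_ /(_ (cst 1) _ _ (fun k => Ck_cst k J _) C0 C0 t Jt)] := Alin.
have -> : (fun s => cst 1 s *: (0 : tangent (gamma s)) + 0) =
    ((fun=> 0) : along gamma).
  by apply/functional_extensionality_dep => s; rewrite scaler0 addr0.
by rewrite scale1r => /eqP; rewrite -subr_eq subrr eq_sym => /eqP.
Qed.

Lemma function_linearB A B : function_linear A -> function_linear B ->
  function_linear (fun X t => A X t - B X t).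
Proof.
move=> [CA Alin] [CB Blin]; split=> [X CX|f X Y Cf CX CY t Jt].
  by apply: smooth_along_sub; [exact: CA|exact: CB].
by rewrite Alin// Blin// scalerBr opprD addrACA.
Qed.

(** Applied to f X, both D A and A D produce the term f' A X, and the
    commutator cancels it. *)
Lemma function_linear_commutator A : function_linear A ->
  function_linear (fun X t => D (A X) t - A (D X) t).
Proof.
move=> LA; have [CA Alin] := LA.
have CD := cov_smooth D_cov.
split=> [X CX|f X Y Cf CX CY t Jt].
  by apply: smooth_along_sub; [exact/CD/CA|exact/CA/CD].
have Cf' := smooth_on_derive1 Cf.
have CfXY := smooth_along_axpy Cf CX CY.
have CfDXY := smooth_along_axpy Cf (CD _ CX) (CD _ CY).
rewrite (cov_local (CA _ CfXY) (smooth_along_axpy Cf (CA _ CX) (CA _ CY)))//;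
  last by move=> s Js; exact: Alin.
rewrite (cov_axpy Cf (CA _ CX) (CA _ CY) Jt).
rewrite (function_linear_eq LA (CD _ CfXY) (smooth_along_axpy Cf' CX CfDXY) Jt);
  last by rewrite (cov_axpy Cf CX CY Jt) addrA.
rewrite (Alin _ _ _ Cf' CX CfDXY t Jt) (Alin _ _ _ Cf (CD _ CX) (CD _ CY) t Jt).
by rewrite -(addrA (_ *: A X t)) [X in X - _]addrC addrKA opprD addrACA scalerBr.
Qed.

Definition tensorial (T : tensor_along gamma) : Prop :=
  forall Y Z, smooth_along J Y -> smooth_along J Z ->
  [/\ function_linear (fun X => T X Y Z), function_linear (fun X => T Y X Z)
    & function_linear (fun X => T Y Z X)].

Lemma tensorial_restrict (T : tensor13 M) : tensorial (restrict_tensor T).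
Proof.
move=> Y Z CY CZ; have CT := smooth_along_tensor J_open gamma_smooth T.
split; split=> [X CX|f X X' _ _ _ t _]; do ?by apply: CT.
- exact: tensorP1.
- exact: tensorP2.
- exact: tensorP3.
Qed.

(** In each slot, [cov_tensor D T] is the commutator of D with T in that slot,
    minus two operators that are function linear by hypothesis. *)
Lemma tensorial_cov T : tensorial T -> tensorial (cov_tensor D T).
Proof.
move=> LT Y Z CY CZ.
have [CDY CDZ] := (cov_smooth D_cov CY, cov_smooth D_cov CZ).
have [T1 T2 T3] := LT Y Z CY CZ.
have [T1Y T2Y T3Y] := LT (D Y) Z CDY CZ.
have [T1Z T2Z T3Z] := LT Y (D Z) CY CDZ.
have C1 := function_linear_commutator T1.
have C2 := function_linear_commutator T2.
have C3 := function_linear_commutator T3.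
split; rewrite /cov_tensor.
- exact: function_linearB (function_linearB C1 T1Y) T1Z.
- have -> : (fun X t => D (T Y X Z) t - T (D Y) X Z t - T Y (D X) Z t
      - T Y X (D Z) t) = (fun X t => D (T Y X Z) t - T Y (D X) Z t
      - T (D Y) X Z t - T Y X (D Z) t).
    apply/funext => X; apply/functional_extensionality_dep => t.
    by congr (_ - _); rewrite addrAC.
  exact: function_linearB (function_linearB C2 T2Y) T2Z.
- have -> : (fun X t => D (T Y Z X) t - T (D Y) Z X t - T Y (D Z) X t
      - T Y Z (D X) t) = (fun X t => D (T Y Z X) t - T Y Z (D X) t
      - T (D Y) Z X t - T Y (D Z) X t).
    apply/funext => X; apply/functional_extensionality_dep => t.
    by rewrite addrAC; congr (_ - _); rewrite addrAC.
  exact: function_linearB (function_linearB C3 T3Y) T3Z.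
Qed.

Lemma smooth_iter_cov n X : smooth_along J X -> smooth_along J (iter n D X).
Proof. by elim: n => //= n IH CX; exact/(cov_smooth D_cov)/IH. Qed.

Lemma iter_cov_local n X Y : smooth_along J X -> smooth_along J Y ->
  (forall s, J s -> X s = Y s) ->
  forall t, J t -> iter n D X t = iter n D Y t.
Proof.
move=> CX CY XY; elim: n => //= n IH.
by apply: cov_local => //; exact: smooth_iter_cov.
Qed.

Lemma iter_covD n X Y t : smooth_along J X -> smooth_along J Y -> J t ->
  iter n D (fun s => X s + Y s) t = iter n D X t + iter n D Y t.
Proof.
elim: n X Y => // n IH X Y CX CY Jt.
have [CDX CDY] := (cov_smooth D_cov CX, cov_smooth D_cov CY).
rewrite !iterSr -(IH _ _ CDX CDY Jt).
apply: iter_cov_local => //; first exact/(cov_smooth D_cov)/smoothD.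
  exact: smoothD.
by move=> s Js; rewrite (covD D_cov CX CY Js).
Qed.

(** * The Leibniz formula along a geodesic *)

Section Geodesic.
Variable Rm : tensor13 M.
Hypothesis gamma_geodesic : geodesic J D.

Definition jacobi_action n X : along gamma :=
  iter n (cov_tensor D) (restrict_tensor Rm) X (velocity gamma) (velocity gamma).

Lemma tensorial_iter n : tensorial (iter n (cov_tensor D) (restrict_tensor Rm)).
Proof.
by elim: n => [|n IH] /=; [exact: tensorial_restrict|exact: tensorial_cov].
Qed.

Lemma function_linear_jacobi n : function_linear (jacobi_action n).
Proof.
have Cv := smooth_velocity J_open gamma_smooth.
by have [] := tensorial_iter n Cv Cv.
Qed.

(** The operator on a single tangent vector may be computed with any smooth
    field through it, in particular with X itself. *)
Lemma jacobi_operatorE n X t : smooth_along J X -> J t ->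
  jacobi_operator J Rm D n (X t) = jacobi_action n X t.
Proof.
move=> CX Jt; rewrite /jacobi_operator /value_at.
set P := [set V | _]; have [CV Vt] : P (xget (fun=> 0) P).
  by apply: (@xgetPex _ (fun=> 0) P); exists X.
exact: (function_linear_eq (function_linear_jacobi n) CV CX Jt Vt).
Qed.

(** The two remaining terms of the Leibniz rule have D gamma' in the second or
    third slot.  Away from J nothing is known of D gamma', so pointwise
    dependence is needed to drop them. *)
Lemma cov_jacobi n X t : smooth_along J X -> J t ->
  D (jacobi_action n X) t = jacobi_action n.+1 X t + jacobi_action n (D X) t.
Proof.
move=> CX Jt; rewrite /jacobi_action /= /cov_tensor.
have Cv := smooth_velocity J_open gamma_smooth.
have CDv := cov_smooth D_cov Cv.
have [_ T2 T3] := tensorial_iter n CX Cv.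
rewrite (function_linear0 T2 CDv Jt (gamma_geodesic Jt)).
rewrite (function_linear0 T3 CDv Jt (gamma_geodesic Jt)).
by rewrite !subr0 subrK.
Qed.

(** The index m is general because the induction trades D^(n+1) (A_m X) for
    D^n (A_(m+1) X) and D^n (A_m (D X)); Pascal's rule adds the two. *)
Lemma iter_cov_jacobi n m X t : smooth_along J X -> J t ->
  iter n D (jacobi_action m X) t =
  \sum_(i < n.+1) jacobi_action (m + n - i) (iter i D X) t *+ 'C(n, i).
Proof.
move=> + Jt; elim: n m X => [|n IH] m X CX.
  by rewrite big_ord_recl big_ord0 addr0 addn0 subn0.
have CDX := cov_smooth D_cov CX.
have CJ k Y : smooth_along J Y -> smooth_along J (jacobi_action k Y).
  exact: (function_linear_jacobi k).1.
rewrite iterSr (@iter_cov_local _ _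
  (fun s => jacobi_action m.+1 X s + jacobi_action m (D X) s))//; first last.
- by move=> s Js; exact: cov_jacobi.
- by apply: smoothD; exact: CJ.
- exact/(cov_smooth D_cov)/CJ.
rewrite iter_covD ?IH//; [|exact: CJ..].
rewrite (sum_binomialS _ (fun i => jacobi_action (m + n.+1 - i) (iter i D X) t)).
congr (_ + _); apply: eq_bigr => i _; first by rewrite addSnnS.
by rewrite addnS subSS iterSr.
Qed.

End Geodesic.

End Operators.

Theorem corollary1p4 (R : realType) (d : nat) (M : manifold R d)
    (M_connected : connected [set: M]) (g : metric M)
    (nabla : vector_field M -> vector_field M -> vector_field M)
    (nabla_LC : levi_civita g nabla)
    (Rm : tensor13 M) (Rm_curv : is_curvature nabla Rm)
    (J : set R) (J_open : open J) (J_itv : is_interval J) (J0 : J 0)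
    (gamma : R -> M) (gamma_smooth : smooth_curve J gamma)
    (D : along gamma -> along gamma)
    (D_cov : covariant_derivative J nabla D)
    (gamma_geodesic : geodesic J D)
    (gamma_unit : g (gamma 0) (velocity gamma 0) (velocity gamma 0) = 1)
    (X : along gamma) (X_smooth : smooth_along J X)
    (n : nat) (n_ge1 : (1 <= n)%N) (t : R) (Jt : J t) :
  jacobi_operator J Rm D n (X t) =
    iter n D (fun s => Rm (gamma s) (X s) (velocity gamma s)
                          (velocity gamma s)) t
    - \sum_(1 <= i < n.+1)
        jacobi_operator J Rm D (n - i) (iter i D X t) *+ 'C(n, i).
Proof.
have jacE k Y : smooth_along J Y ->
    jacobi_operator J Rm D k (Y t) = jacobi_action D Rm k Y t.
  by move=> CY; exact: (jacobi_operatorE J_open gamma_smooth D_cov).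
rewrite -[X in iter n D X]/(jacobi_action D Rm 0 X).
rewrite (iter_cov_jacobi J_open gamma_smooth D_cov Rm gamma_geodesic)//.
rewrite big_ord_recl subn0 add0n bin0 mulr1n.
rewrite big_add1 /= big_mkord jacE//.
rewrite [X in _ - X](eq_bigr (fun i : 'I_n =>
  jacobi_action D Rm (n - i.+1) (iter i.+1 D X) t *+ 'C(n, i.+1))).
  by rewrite addrK.
move=> i _; rewrite jacE//; exact: (@smooth_iter_cov _ _ _ _ _ _ _ D_cov i.+1).
Qed.
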